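(* Let $X$ be a normal space which is locally null with respect to an ideal $\mathscr{I}$ of an upper semi-lattice $(\mathscr{L},\subseteq)$, where $\mathscr{L}\subseteq\mathscr{P}(X)$. Then $C^{\mathscr I}_{00}(X)$ is a normed algebra isometrically isomorphic to $C_{00}(Y)$ for some unique (up to homeomorphism) locally compact Hausdorff space $Y$, namely $Y=\lambda_{\mathscr I} X$. Furthermore: (1) $X$ is dense in $Y$ (in particular $X\subseteq Y$). (2) $C^{\mathscr I}_{00}(X)$ is of empty hull. (3) $C^{\mathscr I}_{00}(X)$ is unital if and only if $\mathscr{I}$ is non-proper if and only if $Y$ is compact.
   Context: A space is a topological space; normal spaces are taken to be Hausdorff, so that the Stone–Čech compactification $\beta X$ exists and contains $X$ as a dense subspace. $\mathscr{P}(X)$ is the power set of $X$. $C_b(X)$ is the normed algebra of continuous bounded $f:X\to\mathbb{R}$ with pointwise operations and the supremum norm. For $f\in C_b(X)$: $\mathrm{z}(f)=f^{-1}(0)$, $\mathrm{coz}(f)=X\setminus\mathrm{z}(f)$, $\mathrm{supp}(f)=\mathrm{cl}_X\mathrm{coz}(f)$. $\mathrm{Coz}(X)$ is the set of all cozero-sets $\mathrm{coz}(f)$ of continuous real-valued functions on $X$. $C_{00}(Y)$ is the set of $f\in C_b(Y)$ with compact support. ''Isometrically isomorphic'' means by an isometric algebra isomorphism. An upper semi-lattice is a partially ordered set in which any two elements $A,B$ have a least upper bound $A\vee B$. For $\mathscr{L}\subseteq\mathscr{P}(X)$ ordered by inclusion, $A\vee B$ is computed in $\mathscr{L}$ and need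 not equal $A\cup B$. An ideal $\mathscr{I}$ in $(\mathscr{L},\subseteq)$ is a non-empty subset of $\mathscr{L}$ such that $A\vee B\in\mathscr{I}$ whenever $A,B\in\mathscr{I}$, and $T\in\mathscr{I}$ whenever $T\in\mathscr{L}$ and $T\subseteq A$ for some $A\in\mathscr{I}$. Elements of $\mathscr{I}$ are called null; $\mathscr{I}$ is proper if $X$ is not null, and non-proper if $X\in\mathscr{I}$. A neighborhood of a set $A$ in $X$ is a set $U\subseteq X$ with $A\subseteq\mathrm{int}_XU$. $X$ is locally null (with respect to $\mathscr{I}$) if every point of $X$ has a null neighborhood in $X$. $C^{\mathscr I}_{00}(X)=\{f\in C_b(X):\mathrm{supp}(f)\text{ has a null neighborhood in }X\}$. $\lambda_{\mathscr I} X=\bigcup\{\mathrm{int}_{\beta X}\mathrm{cl}_{\beta X}C: C\in\mathrm{Coz}(X)\text{ and }\mathrm{cl}_XC\text{ has a null neighborhood in }X\}$, considered as a subspace of $\beta X$. An ideal $H$ of $C_b(X)$ is of empty hull if for every $x\in X$ there is $h\in H$ with $h(x)\neq0$. An algebra is unital if it has a multiplicative unit element. *)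

(* Defs.v *)
From HB Require Import structures.
From mathcomp Require Import all_boot all_order all_algebra.
From mathcomp Require Import all_classical all_reals all_analysis.
Import Order.TTheory GRing.Theory Num.Theory.
Import numFieldNormedType.Exports.

Set Implicit Arguments.
Unset Strict Implicit.
Unset Printing Implicit Defensive.

Local Open Scope classical_set_scope.
Local Open Scope ring_scope.

Definition is_join (X : Type) (L : set (set X)) (A B J : set X) : Prop :=
  [/\ L J, A `<=` J, B `<=` J &
      forall T, L T -> A `<=` T -> B `<=` T -> J `<=` T].

Definition upper_semilattice (X : Type) (L : set (set X)) : Prop :=
  forall A B, L A -> L B -> exists J, is_join L A B J.

Definition lattice_ideal (X : Type) (L I : set (set X)) : Prop :=
  [/\ I `<=` L, I !=set0,
      forall A B J, I A -> I B -> is_join L A B J -> I J &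
      forall A T, I A -> L T -> T `<=` A -> I T].

Definition nonproper (X : Type) (I : set (set X)) : Prop := I [set: X].

(* The neighborhood U is itself required to be null; it need not be open. *)
Definition has_null_nbhd (X : topologicalType) (I : set (set X))
  (A : set X) : Prop := exists2 U, I U & A `<=` interior U.

Definition locally_null (X : topologicalType) (I : set (set X)) : Prop :=
  forall x : X, has_null_nbhd I [set x].

Section FunctionAlgebras.
Context {R : realType}.

Definition Cb (X : topologicalType) : set (X -> R) :=
  [set f | continuous f /\ bounded_fun f].

(* sup set0 = 0, so this is also right for the empty space. *)
Definition sup_norm {X : Type} (f : X -> R) : R :=
  sup [set `|f x| | x in [set: X]].

Definition zeroset (X : Type) (f : X -> R) : set X := f @^-1` [set 0].

Definition coz (X : Type) (f : X -> R) : set X := ~` zeroset f.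

Definition supp (X : topologicalType) (f : X -> R) : set X := closure (coz f).

Definition C00 (Y : topologicalType) : set (Y -> R) :=
  [set f | Cb f /\ compact (supp f)].

Definition C00I (X : topologicalType) (I : set (set X)) : set (X -> R) :=
  [set f | Cb f /\ has_null_nbhd I (supp f)].

Definition algebra_closed (X : Type) (A : set (X -> R)) : Prop :=
  [/\ A 0,
      forall f g, A f -> A g -> A (f + g),
      forall a f, A f -> A (a \*o f) &
      forall f g, A f -> A g -> A (f * g)].

Definition algebra_norm (X : Type) (A : set (X -> R)) (N : (X -> R) -> R)
    : Prop :=
  [/\ forall f, A f -> 0 <= N f,
      forall f, A f -> N f = 0 -> f = 0,
      forall a f, A f -> N (a \*o f) = `|a| * N f,
      forall f g, A f -> A g -> N (f + g) <= N f + N g &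
      forall f g, A f -> A g -> N (f * g) <= N f * N g].

(* The associativity, distributivity etc. laws hold in the whole of X -> R. *)
Definition normed_algebra (X : Type) (A : set (X -> R)) (N : (X -> R) -> R)
    : Prop :=
  algebra_closed A /\ algebra_norm A N.

Definition unital (X : Type) (A : set (X -> R)) : Prop :=
  exists2 u, A u & forall f, A f -> u * f = f /\ f * u = f.

(* The values of phi outside A are irrelevant. *)
Definition isometrically_isomorphic (X Y : Type)
    (A : set (X -> R)) (B : set (Y -> R)) : Prop :=
  exists phi : (X -> R) -> (Y -> R),
    set_bij A B phi /\
    [/\ forall f g, A f -> A g -> phi (f + g) = phi f + phi g,
        forall a f, A f -> phi (a \*o f) = a \*o phi f,
        forall f g, A f -> A g -> phi (f * g) = phi f * phi g &
        forall f, A f -> sup_norm (phi f) = sup_norm f].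

Definition Cb_ideal (X : topologicalType) (H : set (X -> R)) : Prop :=
  [/\ H `<=` @Cb X, H 0,
      forall f g, H f -> H g -> H (f + g) &
      forall f g, Cb f -> H g -> H (f * g)].

Definition empty_hull (X : topologicalType) (H : set (X -> R)) : Prop :=
  Cb_ideal H /\ forall x, exists2 h, H h & h x != 0.

End FunctionAlgebras.

Arguments Cb : clear implicits.
Arguments C00 : clear implicits.
Arguments C00I R {X} I.

Definition homeomorphic (Y Z : topologicalType) : Prop :=
  exists (f : Y -> Z) (g : Z -> Y),
    [/\ cancel f g, cancel g f, continuous f & continuous g].

(** The Stone-Cech compactification, realised as the closure of the image of
    X in the product of lines indexed by C_b(X); see [betaX_compact],
    [betaX_hausdorff], [to_betaX_dense], [to_betaX_inj], [to_betaX_open] and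
    [betaX_extension] for its characteristic properties *)

Section StoneCech.
Context (R : realType) (X : topologicalType).

Definition eval_Cb (x : X) : {ptws Cb R X -> R} := fun f => set_val f x.

Definition betaX : set {ptws Cb R X -> R} := closure (range eval_Cb).

Lemma eval_Cb_betaX (x : X) : eval_Cb x \in betaX.
Proof. by apply/mem_set/subset_closure; exists x. Qed.

Definition to_betaX (x : X) : betaX := SigSub (eval_Cb_betaX x).

Definition Coz : set (set X) :=
  [set C | exists2 f : X -> R, continuous f & C = coz f].

Definition lambdaX (I : set (set X)) : set betaX :=
  \bigcup_(C in [set C | Coz C /\ has_null_nbhd I (closure C)])
     interior (closure (to_betaX @` C)).

Lemma eval_Cb_continuous : continuous eval_Cb.
Proof.
move=> x; apply/cvg_sup => f; move: x.
apply/(@continuousP _ (initial_topology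
  (fun p : forall _ : Cb R X, R => p f))) => A [B oB <-].
change (open (set_val f @^-1` B)).
by apply: open_comp => // y _; exact: (set_mem (valP f)).1.
Qed.

Lemma to_betaX_continuous : continuous to_betaX.
Proof.
move=> x A [_ [[B oB <-] /= Bx] BA].
apply: (filterS (P := eval_Cb @^-1` B)) => [y By|]; first exact: BA.
by apply: eval_Cb_continuous; exact: open_nbhs_nbhs.
Qed.

Lemma to_betaX_dense : dense (range to_betaX).
Proof.
move=> O [p Op] [B oB BO]; move: Op; rewrite -BO => Bp.
have [_ [[x _ <-] Bx]] : range eval_Cb `&` B !=set0.
  by apply: (set_mem (valP p)); exact: open_nbhs_nbhs.
by exists (to_betaX x); split => //; exists x.
Qed.

Lemma betaX_hausdorff : hausdorff_space betaX.
Proof.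
have hP : hausdorff_space {ptws Cb R X -> R}.
  by apply: (@hausdorff_product _ (fun=> R)) => _; exact: Rhausdorff.
move=> p q pq; apply/val_inj/hP => A B pA qB.
have [] := pq (val @^-1` A) (val @^-1` B).
- by apply: initial_continuous.
- by apply: initial_continuous.
by move=> z [Az Bz]; exists (val z).
Qed.

Lemma betaX_compact : compact [set: betaX].
Proof.
have /choice[M fM] (f : Cb R X) : exists M, forall x, `|set_val f x| <= M.
  have [_ [N [_ fN]]] := set_mem (valP f).
  by exists (N + 1) => x; apply: fN => //; rewrite ltrDl.
pose K : set {ptws Cb R X -> R} := [set p | forall f, [set` `[- M f, M f]] (p f)].
have cK : compact K.
  apply: (@tychonoff _ (fun=> R) (fun f => [set` `[- M f, M f]])) => f.
  exact: segment_compact.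
have clK : closed K.
  apply: compact_closed cK.
  by apply: (@hausdorff_product _ (fun=> R)) => _; exact: Rhausdorff.
have cb : compact betaX.
  apply: subclosed_compact cK _; first exact: closed_closure.
  rewrite /betaX (closure_id K).1//; apply: closureS => _ [x _ <-] f /=.
  by rewrite in_itv/= -ler_norml fM.
move=> F FF _.
have [p [bp Fp]] := cb (val @ F) _ (filterE _ (fun q : betaX => set_mem (valP q))).
exists (SigSub (mem_set bp)); split => // A B FA [_ [[C oC <-] /= Cp] CB].
have [_ [[q Aq <-] Cq]] : (val @` A) `&` C !=set0.
  apply: Fp; last exact: open_nbhs_nbhs.
  by apply: (@filterS _ F _ A) => // q Aq; exists q.
by exists q; split => //; exact: CB.
Qed.

Lemma betaX_coord_continuous (f : Cb R X) :
  continuous (fun p : betaX => set_val p f).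
Proof.
apply/continuousP => A oA; exists (@proj _ (fun=> R) f @^-1` A) => //.
apply: open_comp => // q _; exact: (@proj_continuous _ (fun=> R)).
Qed.

Lemma betaX_extension (f : X -> R) : Cb R X f ->
  exists2 g : betaX -> R, continuous g & g \o to_betaX = f.
Proof.
move=> /mem_set Cf; exists (fun p => set_val p (SigSub Cf)); last exact/funext.
exact: betaX_coord_continuous.
Qed.

Lemma to_betaX_nbhs (x : X) (A : set X) :
  hausdorff_space X -> normal_space X -> nbhs x A ->
  exists B : set betaX, [/\ open B, B (to_betaX x) & to_betaX @^-1` B `<=` A].
Proof.
move=> hX nX; rewrite nbhsE => -[V [oV Vx] VA].
have [] := (@uniform_separatorP _ R [set x] (~` V)).1.
  apply: normal_completely_regular => //; first exact: hausdorff_accessible.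
    exact: open_closedC.
move=> f [cf f01 fx fO].
have Cf : f \in Cb R X.
  apply/mem_set; split => //; exists 1; split => // M M1 y _.
  have /= := f01 (f y) (ex_intro2 _ _ y I erefl).
  rewrite in_itv/= => /andP[f0 f1].
  by rewrite ger0_norm// (le_trans f1)// ltW.
exists ((fun p : betaX => set_val p (SigSub Cf)) @^-1` [set r | r < 1]); split.
- apply: open_comp; last exact: open_lt.
  by move=> p _; exact: betaX_coord_continuous.
- have /= fx0 : f x = 0 by apply: fx; exists x.
  by change (f x < 1); rewrite fx0.
move=> y /= fy1; apply: VA; apply: contrapT => /(imageP f)/fO fy.
have {}fy : f y = 1 := fy.
by have : f y < 1 := fy1; rewrite fy ltxx.
Qed.

Lemma to_betaX_inj :
  hausdorff_space X -> normal_space X -> injective to_betaX.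
Proof.
move=> hX nX x y xy; apply: (hX) => A B xA yB; exists y; split; last first.
  exact: nbhs_singleton.
have [C [_ Cx CA]] := to_betaX_nbhs hX nX xA.
by apply: CA; rewrite /= -xy.
Qed.

Lemma to_betaX_open (A : set X) :
  hausdorff_space X -> normal_space X -> open A ->
  exists2 B : set betaX, open B & A = to_betaX @^-1` B.
Proof.
move=> hX nX oA.
exists (\bigcup_(B in [set B | open B /\ to_betaX @^-1` B `<=` A]) B).
  by apply: bigcup_open => B [].
apply/seteqP; split=> [x Ax|x [B [_ BA] Bx]]; last exact: BA.
have [B [oB Bx BA]] := to_betaX_nbhs hX nX (open_nbhs_nbhs (conj oA Ax)).
by exists B.
Qed.

End StoneCech.

Arguments lambdaX R {X} I.

(* Main.v *)
Require Import Defs.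
From HB Require Import structures.
From mathcomp Require Import all_boot all_order all_algebra.
From mathcomp Require Import all_classical all_reals all_analysis.
Import Order.TTheory GRing.Theory Num.Theory.
Import numFieldNormedType.Exports.
Local Open Scope classical_set_scope.
Local Open Scope ring_scope.

(** The space Y = lambdaX is an open subset of the compact Hausdorff space betaX,
    hence locally compact and Hausdorff, and it contains X as a dense subset
    because X is locally null.  Each f in C00I extends to betaX.  The extension
    is supported in the closure of supp f in betaX, and a Urysohn function that is
    1 on supp f and itself belongs to C00I shows that this closure is a compact
    subset of Y ([closure_null_lambdaX]).  Conversely, a compact subset of Y is
    covered by finitely many of the open sets defining Y, and therefore meets X
    in a set with a null neighborhood ([compact_lambdaX_null]), so a function in
    C00(Y) restricts to one in C00I.  As X is dense in Y, extension and
    restriction are inverse isometric isomorphisms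
    ([dense_extension_isometry]).

    Uniqueness of Y holds because a locally compact Hausdorff space can be
    recovered from the algebra of its compactly supported functions: every
    nonzero character of the algebra is evaluation at a point
    ([character_evaluation]), and the cozero-sets of the functions form a base of
    the topology ([C00_iso_homeomorphic]).

    Finally, unitality of C00I, non-properness of the ideal and compactness of Y
    all say that X has a null neighborhood in X.  A unit of C00I is the constant
    1, as C00I is of empty hull, and its support is X; if Y is compact then X is
    the trace of a compact subset of Y; and if X has a null neighborhood, then Y
    contains the closure of X, which is betaX. *)

(** * Compactness and density *)

(** Finite subcovers in the form used below: a property of sets that is
    inherited by subsets and finite unions and holds near each point of K holds
    of K.  If it failed, the sets whose complement in K has the property would
    form a proper filter on K, and a cluster point of that filter would have no
    neighborhood with the property. *)
Lemma compact_induction {T : topologicalType} (P : set T -> Prop) (K : set T) :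
  P set0 -> (forall A B, P A -> P B -> P (A `|` B)) ->
  (forall A B, A `<=` B -> P B -> P A) ->
  compact K -> (forall x, K x -> exists2 U, nbhs x U & P U) -> P K.
Proof.
move=> P0 PU PS cK PK; apply: contrapT => nPK.
pose F : set_system T := [set A | P (K `\` A)].
have FF : ProperFilter F.
  apply: Build_ProperFilter_ex => [A FA|].
    apply: contrapT => /forallNP A0; apply: nPK; apply: PS FA => x Kx.
    by split=> //; exact: A0.
  split; first by rewrite /F /= setDT.
    by move=> A B FA FB; rewrite /F /= setDIr; exact: PU.
  by move=> A B AB; apply: PS; exact: setDS.
have FK : F K by rewrite /F /= setDv.
have [x [Kx clFx]] := cK F FF FK.
have [U Ux PlU] := PK x Kx.
have FU : F (~` U) by apply: PS PlU => y [_ /contrapT].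
by have [y []] := clFx _ _ FU Ux.
Qed.

Lemma dense_eq {S T : topologicalType} (D : set S)
    (f g : S -> T) :
  hausdorff_space T -> dense D -> continuous f -> continuous g ->
  {in D, f =1 g} -> f = g.
Proof.
move=> hT dD cf cg fg; apply/funext => s; apply: hT => A B fA gB.
have : nbhs s (f @^-1` A `&` g @^-1` B).
  by apply: filterI; [exact: cf|exact: cg].
rewrite nbhsE => -[V [oV Vs] VAB].
have [|t [/VAB[At Bt] Dt]] := dD V _ oV; first by exists s.
by exists (f t); split=> //; rewrite fg //; exact/mem_set.
Qed.

Lemma closure_dense_range {S : topologicalType} {T : Type} (j : T -> S)
    (O : set S) :
  dense (range j) -> open O -> O `<=` closure (j @` (j @^-1` O)).
Proof.
move=> dj oO s Os B; rewrite nbhsE => -[V [oV Vs] VB].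
have [|u [[Ou Vu] [t _ jt]]] := dj (O `&` V) _ (openI oO oV).
  by exists s.
by exists u; split; [exists t => //; rewrite /= jt|exact: VB].
Qed.

(** * The algebra of bounded continuous functions and its norm *)

Lemma CbP {R : realType} {X : topologicalType} (f : X -> R) :
  Cb R X f <-> continuous f /\ exists M, forall x, `|f x| <= M.
Proof.
split=> [[cf [N [_ fN]]]|[cf [M fM]]]; split=> //.
  by exists (N + 1) => x; apply: fN => //; rewrite ltrDl.
by exists M; split=> [|y /ltW My x _]; [exact: num_real|exact: le_trans (fM x) My].
Qed.

Lemma Cb_algebra {R : realType} {X : topologicalType} :
  algebra_closed (Cb R X).
Proof.
split.
- by apply/CbP; split; [move=> x; exact: cvg_cst|exists 0 => x; rewrite normr0].
- move=> f g /CbP[cf [M fM]] /CbP[cg [N gN]]; apply/CbP; split.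
    by move=> x; apply: cvgD; [exact: cf|exact: cg].
  by exists (M + N) => x; rewrite (le_trans (ler_normD _ _))// lerD.
- move=> a f /CbP[cf [M fM]]; apply/CbP; split.
    by move=> x; apply: cvgM; [exact: cvg_cst|exact: cf].
  by exists (`|a| * M) => x; rewrite normrM ler_wpM2l.
- move=> f g /CbP[cf [M fM]] /CbP[cg [N gN]]; apply/CbP; split.
    by move=> x; apply: cvgM; [exact: cf|exact: cg].
  by exists (M * N) => x; rewrite normrM ler_pM.
Qed.

Lemma closed_zeroset {R : realType} {X : topologicalType} (f : X -> R) :
  continuous f -> closed (zeroset f).
Proof. by move=> cf; apply: closed_comp => [x _|]; [exact: cf|exact: closed_eq]. Qed.

Lemma open_coz {R : realType} {X : topologicalType} (f : X -> R) :
  continuous f -> open (coz f).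
Proof. by move=> /closed_zeroset; exact: closed_openC. Qed.

Lemma suppD {R : realType} {X : topologicalType} (f g : X -> R) :
  supp (f + g) `<=` supp f `|` supp g.
Proof.
rewrite /supp -closureU; apply: closureS => x /= fg; apply: contrapT => /not_orP.
case=> /contrapT/= fx /contrapT/= gx; apply: fg.
by rewrite /zeroset /= fctE fx gx addr0.
Qed.

Lemma suppM {R : realType} {X : topologicalType} (f g : X -> R) :
  supp (f * g) `<=` supp g.
Proof.
apply: closureS => x /= fg gx; apply: fg.
by move: gx; rewrite /zeroset /= fctE => ->; rewrite mulr0.
Qed.

Lemma supp0 {R : realType} {X : topologicalType} : supp (0 : X -> R) = set0.
Proof. by rewrite /supp (_ : coz _ = set0) ?closure0// -subset0 => x; apply. Qed.

(** The bound M only serves to make the supremum a real one: sup is 0 on sets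
    that are not bounded above. *)
Lemma ler_sup_norm {R : realType} {T : Type} (f : T -> R) (M : R) :
  (forall x, `|f x| <= M) -> forall x, `|f x| <= sup_norm f.
Proof.
by move=> fM x; apply: ub_le_sup; [exists M => _ [y _ <-]|exists x].
Qed.

Lemma sup_norm_ge0 {R : realType} {T : Type} (f : T -> R) : 0 <= sup_norm f.
Proof.
rewrite /sup_norm; have [[[_ [x _ _]] fM]|/sup_out->//] :=
  pselect (has_sup [set `|f x| | x in [set: T]]).
by apply: le_trans (normr_ge0 (f x)) (ub_le_sup fM _); exists x.
Qed.

(** Nonnegativity of M is required because the supremum over an empty space is
    0. *)
Lemma sup_norm_le {R : realType} {T : Type} (f : T -> R) (M : R) :
  0 <= M -> (forall x, `|f x| <= M) -> sup_norm f <= M.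
Proof.
move=> M0 fM; rewrite /sup_norm; set A := [set _ | _ in _].
have [->|/set0P A0] := eqVneq A set0; first by rewrite sup0.
by apply: ge_sup => // _ [x _ <-].
Qed.

Lemma sup_norm_algebra_norm {R : realType} {X : topologicalType}
    (A : set (X -> R)) :
  A `<=` Cb R X -> algebra_norm A (@sup_norm R X).
Proof.
move=> ACb; have bnd f : A f -> forall x, `|f x| <= sup_norm f.
  by move=> /ACb/CbP[_ [M fM]]; exact: ler_sup_norm fM.
split.
- by move=> f _; exact: sup_norm_ge0.
- move=> f Af f0; apply/funext => x; apply/eqP; rewrite -normr_le0 -f0.
  exact: bnd.
- move=> a f Af; apply/eqP; rewrite eq_le; apply/andP; split.
    apply: sup_norm_le => [|x]; first by rewrite mulr_ge0 ?sup_norm_ge0.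
    by rewrite normrM ler_wpM2l// bnd.
  have [->|a0] := eqVneq a 0; first by rewrite normr0 mul0r sup_norm_ge0.
  rewrite -ler_pdivlMl ?normr_gt0//; apply: sup_norm_le => [|x].
    by rewrite mulr_ge0 ?sup_norm_ge0// invr_ge0.
  rewrite ler_pdivlMl ?normr_gt0// -normrM.
  apply: (ler_sup_norm (a \*o f) (`|a| * sup_norm f)) => y.
  by rewrite normrM ler_wpM2l// bnd.
- move=> f g Af Ag; apply: sup_norm_le => [|x].
    by rewrite addr_ge0 ?sup_norm_ge0.
  by rewrite (le_trans (ler_normD _ _))// lerD// bnd.
- move=> f g Af Ag; apply: sup_norm_le => [|x].
    by rewrite mulr_ge0 ?sup_norm_ge0.
  by rewrite normrM ler_pM// bnd.
Qed.

Lemma sup_norm_dense {R : realType} {S : topologicalType} {T : Type}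
    (j : T -> S) (F : S -> R) :
  dense (range j) -> continuous F -> (exists M, forall s, `|F s| <= M) ->
  sup_norm F = sup_norm (F \o j).
Proof.
move=> dj cF [M FM]; apply/eqP; rewrite eq_le; apply/andP; split.
  apply: sup_norm_le => [|s]; first exact: sup_norm_ge0.
  rewrite leNgt; apply/negP => sF.
  pose O := (fun s => `|F s|) @^-1` [set r | sup_norm (F \o j) < r].
  have oO : open O.
    apply: open_comp; last exact: open_gt.
    by move=> y _; apply: cvg_norm; exact: cF.
  have [|u [+ [t _ jt]]] := dj O _ oO; first by exists s.
  rewrite /O /= -jt ltNge => /negP; apply.
  by apply: (ler_sup_norm (F \o j) M) => v; exact: FM.
apply: sup_norm_le => [|x]; first exact: sup_norm_ge0.
exact: ler_sup_norm FM _.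
Qed.

(** Restriction along a dense map is injective on continuous functions, because
    R is Hausdorff, and preserves the supremum; so as soon as it maps B onto A
    its inverse is an isometric isomorphism.  The extension operator phi is
    linear and multiplicative because an extension is determined by its
    restriction. *)
Lemma dense_extension_isometry {R : realType} {S : topologicalType} {T : Type}
    (j : T -> S) (A : set (T -> R)) (B : set (S -> R)) :
  dense (range j) -> algebra_closed A -> B `<=` Cb R S ->
  (forall f, A f -> exists2 F, B F & F \o j = f) ->
  (forall F, B F -> A (F \o j)) ->
  isometrically_isomorphic A B.
Proof.
move=> dj [A0 AD AZ AM] BCb ext res.
have /choice[phi phiP] f : exists F, A f -> B F /\ F \o j = f.
  have [/ext[F BF Fj]|nA] := pselect (A f); first by exists F.
  by exists 0 => /nA.
have Bc F : B F -> continuous F by move=> /BCb/CbP[].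
have [ _ CD CZ CM] := @Cb_algebra R S.
have uniq F G : Cb R S F -> Cb R S G -> F \o j = G \o j -> F = G.
  move=> /CbP[cF _] /CbP[cG _] FG.
  apply: (@dense_eq _ _ _ _ _ (@Rhausdorff R) dj cF cG).
  by move=> _ /set_mem[t _ <-]; exact: (congr1 (fun h => h t) FG).
have pB f : A f -> B (phi f) by move=> /phiP[].
have pj f : A f -> phi f \o j = f by move=> /phiP[].
exists phi; split; first split.
- by move=> f /pB.
- move=> f g /set_mem Af /set_mem Ag pfg.
  by rewrite -(pj f Af) -(pj g Ag) pfg.
- move=> F BF; exists (F \o j); first exact: res.
  by apply: uniq; [exact/BCb/pB/res|exact: BCb|rewrite pj//; exact: res].
split.
- move=> f g Af Ag; apply: uniq; first exact/BCb/pB/AD.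
    by apply: CD; exact/BCb/pB.
  by rewrite pj; [rewrite -{1}(pj f Af) -{1}(pj g Ag)|exact: AD].
- move=> a f Af; apply: uniq; first exact/BCb/pB/AZ.
    by apply: CZ; exact/BCb/pB.
  by rewrite pj; [rewrite -{1}(pj f Af)|exact: AZ].
- move=> f g Af Ag; apply: uniq; first exact/BCb/pB/AM.
    by apply: CM; exact/BCb/pB.
  by rewrite pj; [rewrite -{1}(pj f Af) -{1}(pj g Ag)|exact: AM].
- move=> f Af; have /CbP[cF bF] := BCb _ (pB f Af).
  by rewrite -{2}(pj f Af); exact: sup_norm_dense.
Qed.

(** * Compactly supported functions determine the space *)

Lemma eq0_outside_supp {R : realType} {X : topologicalType} (f : X -> R) (x : X) :
  ~ supp f x -> f x = 0.
Proof. by move=> nfx; apply: contrapT => fx; apply: nfx; exact: subset_closure. Qed.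

(** A continuous function is bounded near each point, hence on its support when
    that is compact, and it is 0 elsewhere. *)
Lemma C00P {R : realType} {Y : topologicalType} (f : Y -> R) :
  C00 R Y f <-> continuous f /\ compact (supp f).
Proof.
split=> [[[]]//|[cf sf]]; split=> //; apply/CbP; split=> //.
pose P (S : set Y) := exists M, forall y, S y -> `|f y| <= M.
have [] // : P (supp f).
  apply: compact_induction sf _ => //.
  - by exists 0.
  - move=> A B [M AM] [N BN]; exists (Num.max M N) => y.
    by case=> [/AM|/BN] h; rewrite le_max h ?orbT.
  - by move=> A B AB [M BM]; exists M => y /AB/BM.
  - move=> y _; exists ((fun y => `|f y|) @^-1` [set r | r < `|f y| + 1]).
      apply: open_nbhs_nbhs; split; last by rewrite /= ltrDl.
      apply: open_comp; last exact: open_lt.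
      by move=> z _; apply: cvg_norm; exact: cf.
    by exists (`|f y| + 1) => z /ltW.
move=> M fM; exists (Num.max M 0) => y.
have [/fM h|/eq0_outside_supp->] := pselect (supp f y); first by rewrite le_max h.
by rewrite normr0 le_max lexx orbT.
Qed.

(** Compactly supported functions generate the topology: this provides
    nonvanishing functions, separates points and describes neighborhoods. *)
Lemma C00_bump {R : realType} {Y : topologicalType} (y : Y) (V : set Y) :
  locally_compact [set: Y] -> hausdorff_space Y -> nbhs y V ->
  exists2 f, C00 R Y f & f y = 1 /\ coz f `<=` V.
Proof.
move=> lcY hY Vy; have [K yK [cK clK]] := lcY y I.
have {}yK : nbhs y K by move: yK; rewrite /within /=; apply: filterS => z; apply.
pose B := ~` interior (V `&` K).
have clB : closed B by exact/open_closedC/open_interior.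
have nBy : ~ B y by apply; exact: filterI.
have [g [cg _ g0 g1]] := (@uniform_separatorP _ R _ _).1
  (locally_compact_completely_regular (R := R) lcY hY clB nBy).
have fVK : coz (fun z => 1 - g z) `<=` V `&` K.
  move=> z fz; suff : interior (V `&` K) z by move/interior_subset.
  apply: contrapT => Bz.
  have gz : g z = 1 := g1 _ (ex_intro2 _ _ z Bz erefl).
  by apply: fz; rewrite /zeroset /= gz subrr.
exists (fun z => 1 - g z); last first.
  split; last by move=> z /fVK[].
  by rewrite (g0 (g y) (ex_intro2 _ _ y erefl erefl)) subr0.
apply/C00P; split; first by move=> z; apply: cvgB; [exact: cvg_cst|exact: cg].
apply: (subclosed_compact _ cK); first exact: closed_closure.
by rewrite (closure_id K).1//; apply: closureS => z /fVK[].
Qed.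

Definition nonzero_character {R : realType} {T : Type} (A : set (T -> R))
    (chi : (T -> R) -> R) : Prop :=
  [/\ forall f g, A f -> A g -> chi (f + g) = chi f + chi g,
      forall a f, A f -> chi (a \*o f) = a * chi f,
      forall f g, A f -> A g -> chi (f * g) = chi f * chi g &
      exists2 e, A e & chi e != 0].

Definition algebra_iso {R : realType} {T S : Type} (A : set (T -> R))
    (B : set (S -> R)) (phi : (T -> R) -> S -> R) : Prop :=
  set_bij A B phi /\
  [/\ forall f g, A f -> A g -> phi (f + g) = phi f + phi g,
      forall a f, A f -> phi (a \*o f) = a \*o phi f &
      forall f g, A f -> A g -> phi (f * g) = phi f * phi g].

(** The quotient is continuous because every point either has s nonzero nearby
    or lies outside supp e, where e vanishes identically nearby.
    Where s vanishes, so does e, hence s times the quotient is e there too. *)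
Lemma C00_quotient {R : realType} {Y : topologicalType} (e s : Y -> R) :
  C00 R Y e -> continuous s -> (forall y, supp e y -> s y != 0) ->
  exists2 q, C00 R Y q & s * q = e.
Proof.
move=> /C00P[ce ke] cs s0; exists (fun y => (s y)^-1 * e y).
  apply/C00P; split.
    move=> y; have [/s0 sy|nsy] := pselect (supp e y).
      by apply: cvgM; [apply: cvgV => //; exact: cs|exact: ce].
    have e0 : \forall z \near y, (s z)^-1 * e z = 0.
      have : open (~` supp e) by exact/closed_openC/closed_closure.
      rewrite openE => /(_ y nsy); apply: filterS => z /eq0_outside_supp ->.
      by rewrite mulr0.
    by rewrite /continuous_at (nbhs_singleton e0); exact: cvg_near_cst.
  apply: (subclosed_compact _ ke); first exact: closed_closure.
  by apply: closureS => y /= qy ey; apply: qy; rewrite /zeroset /= ey mulr0.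
apply/funext => y; rewrite fctE.
have [/s0 sy|/eq0_outside_supp->] := pselect (supp e y); first by rewrite mulrA divff// mul1r.
by rewrite !mulr0.
Qed.

(** The kernel of a character cannot generate the unit ideal locally
    everywhere.  Otherwise, for e with chi e nonzero, squares of kernel elements
    are summed up to an s in the kernel with phi s > 0 on the compact support of
    phi e; then phi e is a multiple of phi s by [C00_quotient], and chi e = 0. *)
Lemma character_kernel_point {R : realType} {T : Type} {Y : topologicalType}
    (A : set (T -> R)) (phi : (T -> R) -> Y -> R) (chi : (T -> R) -> R) :
  algebra_closed A -> algebra_iso A (C00 R Y) phi -> nonzero_character A chi ->
  exists y, forall f, A f -> chi f = 0 -> phi f y = 0.
Proof.
move=> [A0 AD AZ AM] [[pA pI pS] [pD pZ pM]] [xD xZ xM [e Ae e0]].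
apply: contrapT => /forallNP nker.
have {}nker y : exists f, [/\ A f, chi f = 0 & phi f y != 0].
  have /existsNP[f /not_implyP[Af /not_implyP[f0 /eqP fy]]] := nker y.
  by exists f.
have pc f : A f -> continuous (phi f) by move=> /pA/C00P[].
have chi0 : chi 0 = 0.
  have -> : (0 : T -> R) = 0 \*o e by apply/funext => t; rewrite /= mul0r.
  by rewrite xZ// mul0r.
have phi0 : phi 0 = 0.
  have -> : (0 : T -> R) = 0 \*o e by apply/funext => t; rewrite /= mul0r.
  by rewrite pZ//; apply/funext => y; rewrite /= mul0r.
pose P (S : set Y) := exists s, [/\ A s, chi s = 0, (forall y, 0 <= phi s y) &
  forall y, S y -> 0 < phi s y].
have [s [As s0 _ sK]] : P (supp (phi e)).
  apply: compact_induction; last 2 first.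
  - by have /C00P[] := pA _ Ae.
  - move=> y _; have [f [Af f0 fy]] := nker y.
    exists (coz (phi f)).
      apply: open_nbhs_nbhs; split; first exact/open_coz/pc.
      by apply/eqP.
    exists (f * f); split; first exact: AM.
    + by rewrite xM// f0 mulr0.
    + by move=> z; rewrite pM// fctE -expr2 sqr_ge0.
    + move=> z /= fz; rewrite pM// fctE -expr2 lt_neqAle sqr_ge0 andbT eq_sym.
      by rewrite sqrf_eq0; apply/eqP.
  - by exists 0; split=> // y; rewrite phi0.
  - move=> S1 S2 [s [As s0 sge sgt]] [t [At t0 tge tgt]]; exists (s + t); split.
    + exact: AD.
    + by rewrite xD// s0 t0 addr0.
    + by move=> y; rewrite pD// fctE addr_ge0.
    + move=> y; rewrite pD// fctE => -[/sgt h|/tgt h].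
        by rewrite ltr_wpDr.
      by rewrite ltr_wpDl.
  - by move=> S1 S2 S12 [s [As s0 sge sgt]]; exists s; split=> // y /S12/sgt.
have [y /sK|q Cq sq] := C00_quotient _ _ (pA _ Ae) (pc _ As).
  by rewrite lt0r => /andP[].
have [c Ac pcq] := pS _ Cq.
have ec : e = s * c.
  by apply: pI; [exact/mem_set|exact/mem_set/AM|rewrite pM// pcq].
by move: e0; rewrite ec xM// s0 mul0r eqxx.
Qed.

(** At the point y of [character_kernel_point], evaluation is proportional to
    chi, since for chi e = 1 the function f - chi f *: e is in the kernel.  The
    factor phi e y is idempotent, and it is nonzero because C00 has a function
    that does not vanish at y. *)
Lemma character_evaluation {R : realType} {T : Type} {Y : topologicalType}
    (A : set (T -> R)) (phi : (T -> R) -> Y -> R) (chi : (T -> R) -> R) :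
  locally_compact [set: Y] -> hausdorff_space Y ->
  algebra_closed A -> algebra_iso A (C00 R Y) phi -> nonzero_character A chi ->
  exists y, forall f, A f -> chi f = phi f y.
Proof.
move=> lcY hY algA isoA chiA.
have [y kery] := character_kernel_point _ _ _ algA isoA chiA.
case: algA isoA chiA => [A0 AD AZ AM] [[pA pI pS] [pD pZ pM]].
move=> [xD xZ xM [e' Ae' e'0]].
exists y; pose e := (chi e')^-1 \*o e'.
have Ae : A e by exact: AZ.
have e1 : chi e = 1 by rewrite xZ// mulVf.
have pe f : A f -> phi f y = chi f * phi e y.
  move=> Af; apply/eqP; rewrite -subr_eq0 -mulNr.
  have Ae_ : A (- chi f \*o e) by exact: AZ.
  have := kery _ (AD _ _ Af Ae_); rewrite xD// xZ// e1 mulr1 subrr pD// pZ//.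
  by move=> /(_ erefl)/eqP.
suff e1y : phi e y = 1 by move=> f /pe ->; rewrite e1y mulr1.
have [b Cb [by1 _]] : exists2 f, C00 R Y f & f y = 1 /\ coz f `<=` setT.
  by apply: C00_bump => //; exact: filterT.
have [a Aa pab] := pS _ Cb.
have ey0 : phi e y != 0.
  apply/eqP => ey0; have := pe a Aa.
  by rewrite pab by1 ey0 mulr0 => /eqP; rewrite oner_eq0.
have := pe _ (AM _ _ Ae Ae); rewrite pM// xM// e1 !mul1r fctE.
by move=> idem; apply: (mulfI ey0); rewrite mulr1.
Qed.

(** Evaluation at a point of Z is a character of A, hence evaluation at a point
    of Y, and conversely.  The resulting maps are mutually inverse since C00
    separates points, and continuous since the cozero-sets of C00 functions form
    a base. *)
Lemma C00_iso_homeomorphic {R : realType} {T : Type} {Y Z : topologicalType}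
    (A : set (T -> R)) :
  algebra_closed A ->
  locally_compact [set: Y] -> hausdorff_space Y ->
  locally_compact [set: Z] -> hausdorff_space Z ->
  isometrically_isomorphic A (C00 R Y) ->
  isometrically_isomorphic A (C00 R Z) -> homeomorphic Z Y.
Proof.
move=> algA lcY hY lcZ hZ [phi [phib [phiD phiZ phiM _]]].
move=> [psi [psib [psiD psiZ psiM _]]].
have isophi : algebra_iso A (C00 R Y) phi by [].
have isopsi : algebra_iso A (C00 R Z) psi by [].
have ev (S : topologicalType) (rho : (T -> R) -> S -> R) (s : S) :
    locally_compact [set: S] -> hausdorff_space S ->
    algebra_iso A (C00 R S) rho -> nonzero_character A (rho ^~ s).
  move=> lcS hS [[_ _ rS] [rD rZ rM]]; split.
  - by move=> f g Af Ag; rewrite rD.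
  - by move=> a f Af; rewrite rZ.
  - by move=> f g Af Ag; rewrite rM.
  have [b Cb [bs _]] : exists2 f, C00 R S f & f s = 1 /\ coz f `<=` setT.
    by apply: C00_bump => //; exact: filterT.
  by have [e Ae rb] := rS _ Cb; exists e => //; rewrite rb bs oner_neq0.
have /choice[a aP] z := character_evaluation A phi (psi ^~ z) lcY hY algA
  isophi (ev _ _ z lcZ hZ isopsi).
have /choice[b bP] y := character_evaluation A psi (phi ^~ y) lcZ hZ algA
  isopsi (ev _ _ y lcY hY isophi).
(* A, transported to C00 of S, inherits the bump functions of S. *)
have sep (S : topologicalType) (rho : (T -> R) -> S -> R) (s : S) (V : set S) :
    locally_compact [set: S] -> hausdorff_space S ->
    algebra_iso A (C00 R S) rho -> nbhs s V ->
    exists2 f, A f & rho f s = 1 /\ coz (rho f) `<=` V.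
  move=> lcS hS [[_ _ rS] _] sV.
  have [f Cf fs] := C00_bump (R := R) _ _ lcS hS sV.
  by have [g Ag gf] := rS _ Cf; exists g => //; rewrite gf.
have inv (S : topologicalType) (rho : (T -> R) -> S -> R) (s t : S) :
    locally_compact [set: S] -> hausdorff_space S ->
    algebra_iso A (C00 R S) rho -> (forall f, A f -> rho f s = rho f t) -> t = s.
  move=> lcS hS isorho st; apply: (hS) => V U tV sU; exists t.
  split; first exact: nbhs_singleton.
  have [f Af [fs fU]] := sep _ _ _ _ lcS hS isorho sU.
  by apply: fU => /eqP; rewrite -st// fs oner_eq0.
have cont (S S' : topologicalType) (rho : (T -> R) -> S -> R)
    (rho' : (T -> R) -> S' -> R) (c : S -> S') :
    locally_compact [set: S'] -> hausdorff_space S' ->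
    algebra_iso A (C00 R S) rho -> algebra_iso A (C00 R S') rho' ->
    (forall s f, A f -> rho f s = rho' f (c s)) -> continuous c.
  move=> lcS hS [[rA _ _] _] isorho' cP s V sV.
  have [f Af [fs fV]] := sep _ _ _ _ lcS hS isorho' sV.
  apply: (@filterS _ _ _ (coz (rho f))).
    by move=> t ft; apply: fV; rewrite /coz /zeroset /= -cP.
  apply: open_nbhs_nbhs; split.
    by apply: open_coz; have /C00P[] := rA _ Af.
  by rewrite /coz /zeroset /= cP// fs; apply/eqP; rewrite oner_neq0.
exists a, b; split.
- by move=> z; apply: (inv _ psi) => // f Af; rewrite aP// bP.
- by move=> y; apply: (inv _ phi) => // f Af; rewrite bP// aP.
- exact: (cont _ _ psi phi).
- exact: (cont _ _ phi psi).
Qed.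

(** * Null neighborhoods *)

Lemma has_null_nbhdS {X : topologicalType} (I : set (set X)) (A B : set X) :
  A `<=` B -> has_null_nbhd I B -> has_null_nbhd I A.
Proof. by move=> AB [U IU BU]; exists U => //; exact: subset_trans BU. Qed.

Lemma has_null_nbhd0 {X : topologicalType} (L I : set (set X)) :
  lattice_ideal L I -> has_null_nbhd I set0.
Proof. by move=> [_ [A IA] _ _]; exists A. Qed.

(** The join of two null sets contains their union, although it may be
    larger. *)
Lemma has_null_nbhdU {X : topologicalType} (L I : set (set X)) (A B : set X) :
  upper_semilattice L -> lattice_ideal L I ->
  has_null_nbhd I A -> has_null_nbhd I B -> has_null_nbhd I (A `|` B).
Proof.
move=> latL [IL _ IJ _] [U IU AU] [V IV BV].
have [J JP] := latL U V (IL U IU) (IL V IV).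
have [_ UJ VJ _] := JP; exists J; first exact: IJ JP.
by move=> x [/AU|/BV]; apply: filterS.
Qed.

Lemma null_nbhd_setT {X : topologicalType} (I : set (set X)) :
  has_null_nbhd I [set: X] <-> nonproper I.
Proof.
split=> [[U IU TU]|IT]; last by exists setT => //; rewrite interiorT.
rewrite /nonproper (_ : setT = U)//; apply/seteqP; split=> // x xT.
by have /interior_subset := TU x xT.
Qed.

(** Normality makes the separating function g vanish off an open V with
    closure V inside the interior of the null neighborhood, so that the support
    of g, and not only its cozero-set, has a null neighborhood. *)
Lemma null_urysohn {R : realType} {X : topologicalType} (I : set (set X))
    (A : set X) :
  normal_space X -> closed A -> has_null_nbhd I A ->
  exists2 g, C00I R I g & forall x, A x -> g x = 1.
Proof.
move=> nX clA [U IU AU].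
have [|V [W [oV oW AV UW VW0]]] := (@normal_openP R X).1 nX A (~` interior U) clA
  (open_closedC (@open_interior _ U)); first exact/(subsets_disjoint A).
have AVC : ~` V `&` A = set0.
  by rewrite setIC; exact/(subsets_disjoint A).
have [g [cg g01 g0 g1]] := (@uniform_separatorP _ R _ _).1
  ((@normal_separatorP R X).1 nX _ _ (open_closedC oV) clA AVC).
exists g; last by move=> x Ax; exact: (g1 (g x) (ex_intro2 _ _ x Ax erefl)).
split.
  apply/CbP; split=> //; exists 1 => x.
  have /= := g01 (g x) (ex_intro2 _ _ x Logic.I erefl).
  by rewrite in_itv /= => /andP[gx0 gx1]; rewrite ger0_norm.
exists U => // x gx; apply: contrapT => /UW Wx.
have [y [/= gy Wy]] := gx W (open_nbhs_nbhs (conj oW Wx)).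
have Vy : V y.
  by apply: contrapT => nVy; apply: gy; exact: (g0 (g y) (ex_intro2 _ _ y nVy erefl)).
by have : (V `&` W) y by []; rewrite VW0.
Qed.

Lemma C00I_sub_Cb {R : realType} {X : topologicalType} (I : set (set X)) :
  C00I R I `<=` Cb R X.
Proof. by move=> f []. Qed.

Lemma C00I_Cb_ideal {R : realType} {X : topologicalType} (L I : set (set X)) :
  upper_semilattice L -> lattice_ideal L I -> Cb_ideal (C00I R I).
Proof.
move=> latL idI; have [Cb0 CbD CbZ CbM] := @Cb_algebra R X.
split; first exact: C00I_sub_Cb.
- by split=> //; rewrite supp0; exact: has_null_nbhd0 idI.
- move=> f g [Cf If] [Cg Ig]; split; first exact: CbD.
  by apply: has_null_nbhdS (suppD f g) _; exact: has_null_nbhdU idI If Ig.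
- move=> f g Cf [Cg Ig]; split; first exact: CbM.
  exact: has_null_nbhdS (suppM f g) Ig.
Qed.

(** Scalars act as bounded constant functions. *)
Lemma Cb_ideal_algebra {R : realType} {X : topologicalType} (H : set (X -> R)) :
  Cb_ideal H -> algebra_closed H.
Proof.
move=> [HCb H0 HD HM]; split=> // [a f Hf|f g /HCb]; last exact: HM.
have -> : a \*o f = cst a * f by [].
apply: HM Hf; apply/CbP; split; first by move=> x; exact: cvg_cst.
by exists `|a|.
Qed.

Lemma C00I_empty_hull {R : realType} {X : topologicalType}
    (L I : set (set X)) :
  hausdorff_space X -> normal_space X ->
  upper_semilattice L -> lattice_ideal L I -> locally_null I ->
  empty_hull (C00I R I).
Proof.
move=> hX nX latL idI nullX; split=> [|x]; first exact: C00I_Cb_ideal idI.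
have clx := accessible_closed_set1 (hausdorff_accessible hX) (x := x).
have [g Ig g1] := null_urysohn (R := R) _ _ nX clx (nullX x).
by exists g => //; rewrite g1// oner_neq0.
Qed.

(** A unit u of an algebra of empty hull is nowhere 0, so its support is X. *)
Lemma unital_C00I_nonproper {R : realType} {X : topologicalType}
    (I : set (set X)) :
  empty_hull (C00I R I) -> unital (C00I R I) <-> nonproper I.
Proof.
move=> [_ hull]; split=> [[u [_ Iu] uP]|IT].
  apply/null_nbhd_setT; apply: has_null_nbhdS Iu => x _.
  apply: subset_closure => ux; have [f /uP[uf _] /eqP[]] := hull x.
  by rewrite -uf fctE [u x]ux mul0r.
exists (cst 1).
  split; last by apply: has_null_nbhdS ((null_nbhd_setT I).2 IT).
  by apply/CbP; split; [move=> x; exact: cvg_cst|exists 1 => x; rewrite normr1].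
by move=> f _; split; apply/funext => x; rewrite fctE ?mul1r ?mulr1.
Qed.

(** * Subspaces *)

Lemma compact_set_val {S : topologicalType} (D K : set S) :
  K `<=` D -> compact K -> compact (set_val @^-1` K : set D).
Proof.
move=> KD cK F FF FK.
have [s [Ks Fs]] := cK (set_val @ F) _ FK.
exists (SigSub (mem_set (KD s Ks))); split=> // A B FA [_ [[C oC <-] /= Cs] CB].
have [_ [[q Aq <-] Cq]] : (set_val @` A) `&` C !=set0.
  apply: Fs; last exact: open_nbhs_nbhs.
  by apply: (@filterS _ F _ A) => // q Aq; exists q.
by exists q; split => //; exact: CB.
Qed.

Lemma set_val_continuous {S : topologicalType} (D : set S) :
  continuous (set_val : D -> S).
Proof. exact: initial_continuous. Qed.

Lemma hausdorff_set_val {S : topologicalType} (D : set S) :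
  hausdorff_space S -> hausdorff_space D.
Proof.
move=> hS p q pq; apply/val_inj/hS => A B pA qB.
have [] := pq (set_val @^-1` A) (set_val @^-1` B).
- exact: set_val_continuous.
- exact: set_val_continuous.
by move=> z [Az Bz]; exists (set_val z).
Qed.

Lemma locally_compact_open_sub {S : topologicalType} (D : set S) :
  hausdorff_space S -> compact [set: S] -> open D ->
  locally_compact [set: D].
Proof.
move=> hS cS oD y _.
have yD : nbhs (set_val y) D by apply: open_nbhs_nbhs; split=> //; exact: set_valP.
have [K yK KD] := compact_regular hS cS filterT yD.
exists (set_val @^-1` closure K : set D).
  have yK' : nbhs (set_val y) (closure K).
    by apply: filterS yK; exact: subset_closure.
  rewrite /within /=.
  have Ky : nbhs y (set_val @^-1` closure K) by exact: set_val_continuous.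
  by apply: filterS Ky => z Kz _.
split.
  apply: compact_set_val => //.
  by apply: subclosed_compact cS _ => //; exact: closed_closure.
by apply: closed_comp => [z _|]; [exact: set_val_continuous|exact: closed_closure].
Qed.

(** * The space lambdaX inside the Stone-Cech compactification *)

Lemma closure_to_betaX {R : realType} {X : topologicalType} (C : set X) (x : X) :
  hausdorff_space X -> normal_space X ->
  closure (@to_betaX R X @` C) (to_betaX R x) -> closure C x.
Proof.
move=> hX nX Cx B xB; have [V [oV Vx VB]] := to_betaX_nbhs R hX nX xB.
have [_ [[y Cy <-] Vy]] := Cx V (open_nbhs_nbhs (conj oV Vx)).
by exists y; split=> //; exact: VB.
Qed.

(** With g in C00I equal to 1 on A and G its extension to betaX, the closure of
    A lies in the set G = 1, which lies in the open set coz G, which lies in the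
    closure of coz g by density.  So the interior of the closure of the single
    cozero-set coz g already contains the closure of A. *)
Lemma closure_null_lambdaX {R : realType} {X : topologicalType}
    (I : set (set X)) (A : set X) :
  normal_space X -> closed A -> has_null_nbhd I A ->
  closure (@to_betaX R X @` A) `<=` lambdaX R I.
Proof.
move=> nX clA IA p Ap; have [g [Cg Ig] g1] := null_urysohn (R := R) _ _ nX clA IA.
have [G cG Gg] := betaX_extension Cg; exists (coz g).
  by split=> //; exists g => //; case: Cg.
have Gp : G p = 1.
  have clG1 : closed (G @^-1` [set 1]).
    by apply: closed_comp => [q _|]; [exact: cG|exact: closed_eq].
  apply: clG1; apply: closureS Ap => _ [x Ax <-] /=.
  by rewrite -(g1 _ Ax) -Gg.
have cozGg : @to_betaX R X @^-1` coz G = coz g by rewrite -Gg.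
apply: (@filterS _ _ _ (coz G)); first rewrite -cozGg.
  by apply: closure_dense_range; [exact: to_betaX_dense|exact: open_coz].
apply: open_nbhs_nbhs; split; first exact: open_coz.
by rewrite /coz /zeroset /= Gp; apply/eqP; rewrite oner_neq0.
Qed.

Lemma to_betaX_lambdaX {R : realType} {X : topologicalType} (I : set (set X)) :
  hausdorff_space X -> normal_space X -> locally_null I ->
  range (@to_betaX R X) `<=` lambdaX R I.
Proof.
move=> hX nX nullX _ [x _ <-].
have clx := accessible_closed_set1 (hausdorff_accessible hX) (x := x).
apply: (closure_null_lambdaX _ _ nX clx (nullX x)).
by apply: subset_closure; exists x.
Qed.

Lemma open_lambdaX {R : realType} {X : topologicalType} (I : set (set X)) :
  open (lambdaX R I).
Proof. by apply: bigcup_open => C _; exact: open_interior. Qed.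

(** The support of the extension lies in the closure of supp f in betaX, which is
    compact, and contained in lambdaX by [closure_null_lambdaX]. *)
Lemma C00I_extension {R : realType} {X : topologicalType} (I : set (set X))
    (j : X -> lambdaX R I) (f : X -> R) :
  normal_space X -> (forall x, set_val (j x) = to_betaX R x) -> C00I R I f ->
  exists2 F, C00 R (lambdaX R I) F & F \o j = f.
Proof.
move=> nX jP [Cf If]; have [F cF Ff] := betaX_extension Cf.
exists (F \o set_val); last first.
  by apply/funext => x; rewrite /= jP -Ff.
apply/C00P; split.
  by move=> y; apply: continuous_comp; [exact: set_val_continuous|exact: cF].
pose K := closure (@to_betaX R X @` supp f).
have KY : K `<=` lambdaX R I by apply: closure_null_lambdaX => //; exact: closed_closure.
have cK : compact K.
  by apply: subclosed_compact (@betaX_compact R X) _ => //; exact: closed_closure.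
apply: subclosed_compact (compact_set_val _ _ KY cK) _; first exact: closed_closure.
have clK : closed (set_val @^-1` K : set (lambdaX R I)).
  by apply: closed_comp => [z _|]; [exact: set_val_continuous|exact: closed_closure].
rewrite ((closure_id _).1 clK); apply: closureS => y Fy.
have : closure (@to_betaX R X @` (@to_betaX R X @^-1` coz F)) (set_val y).
  by apply: closure_dense_range; [exact: to_betaX_dense|exact: open_coz|exact: Fy].
by apply: closureS; apply: image_subset => x; rewrite -Ff; exact: subset_closure.
Qed.

(** Each point of lambdaX is interior to the closure in betaX of some C whose
    closure in X has a null neighborhood, and this closure in betaX traces the
    closure of C on X; finite unions are handled by the joins. *)
Lemma compact_lambdaX_null {R : realType} {X : topologicalType}
    (L I : set (set X)) (j : X -> lambdaX R I) (K : set (lambdaX R I)) :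
  hausdorff_space X -> normal_space X ->
  upper_semilattice L -> lattice_ideal L I ->
  (forall x, set_val (j x) = to_betaX R x) ->
  compact K -> has_null_nbhd I (j @^-1` K).
Proof.
move=> hX nX latL idI jP cK.
apply: (compact_induction (fun S => has_null_nbhd I (j @^-1` S))) cK _ => /=.
- exact: has_null_nbhd0 idI.
- by move=> A B IA IB; rewrite preimage_setU; exact: has_null_nbhdU idI IA IB.
- by move=> A B AB; apply: has_null_nbhdS => x; exact: AB.
- move=> y _; have [C [_ IC] Cy] := set_valP y.
  exists (set_val @^-1` interior (closure (@to_betaX R X @` C))).
    by apply: set_val_continuous; exact: nbhs_interior.
  apply: has_null_nbhdS IC => x /=; rewrite jP => /interior_subset.
  exact: closure_to_betaX.
Qed.

Lemma C00_restriction {R : realType} {X : topologicalType}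
    (L I : set (set X)) (j : X -> lambdaX R I) (F : lambdaX R I -> R) :
  hausdorff_space X -> normal_space X ->
  upper_semilattice L -> lattice_ideal L I ->
  (forall x, set_val (j x) = to_betaX R x) -> continuous j ->
  C00 R (lambdaX R I) F -> C00I R I (F \o j).
Proof.
move=> hX nX latL idI jP cj [/CbP[cF [M FM]] sF]; split.
  apply/CbP; split; last by exists M => x; exact: FM.
  by move=> x; apply: continuous_comp; [exact: cj|exact: cF].
apply: has_null_nbhdS (compact_lambdaX_null _ _ _ _ hX nX latL idI jP sF).
have clF : closed (j @^-1` supp F).
  by apply: closed_comp => [z _|]; [exact: cj|exact: closed_closure].
by rewrite ((closure_id _).1 clF); apply: closureS => x Fx; exact: subset_closure.
Qed.

(** * The representation theorem *)

Theorem theorem2p14 (R : realType) (X : topologicalType)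
    (L I : set (set X))
    (hausdorffX : hausdorff_space X) (normalX : normal_space X)
    (latticeL : upper_semilattice L) (idealI : lattice_ideal L I)
    (nullX : locally_null I) :
  let Y : topologicalType := lambdaX R I in
  [/\ normed_algebra (C00I R I) (@sup_norm R X),
      [/\ locally_compact [set: Y], hausdorff_space Y &
          isometrically_isomorphic (C00I R I) (C00 R Y)],
      (forall Z : topologicalType,
         locally_compact [set: Z] -> hausdorff_space Z ->
         isometrically_isomorphic (C00I R I) (C00 R Z) -> homeomorphic Z Y) &
      [/\ range (@to_betaX R X) `<=` lambdaX R I /\
            dense (set_val @^-1` range (@to_betaX R X) : set Y),
          empty_hull (C00I R I) &
          (unital (C00I R I) <-> nonproper I) /\
            (nonproper I <-> compact [set: Y])]].
Proof.
move=> Y; have XY := to_betaX_lambdaX (R := R) _ hausdorffX normalX nullX.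
pose j (x : X) : Y := SigSub (mem_set (XY _ (ex_intro2 _ _ x Logic.I erefl))).
have jP x : set_val (j x) = to_betaX R x by [].
have cj : continuous j.
  move=> x A [_ [[B oB <-] /= Bx] BA].
  apply: (@filterS _ _ _ (@to_betaX R X @^-1` B)) => [y By|]; first exact: BA.
  by apply: to_betaX_continuous; exact: open_nbhs_nbhs.
have densej : dense (range j).
  move=> O [p Op] [B oB BO]; move: Op; rewrite -BO => Bp.
  have [|q [Bq [x _ xq]]] := @to_betaX_dense R X B _ oB.
    by exists (set_val p).
  by exists (j x); split; [rewrite /= jP xq|exists x].
have hull := C00I_empty_hull (R := R) _ _ hausdorffX normalX latticeL idealI nullX.
have algA := Cb_ideal_algebra _ hull.1.
have lcY : locally_compact [set: Y].
  apply: locally_compact_open_sub; [exact: betaX_hausdorff|exact: betaX_compact|].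
  exact: open_lambdaX.
have hY : hausdorff_space Y by apply: hausdorff_set_val; exact: betaX_hausdorff.
have isoY : isometrically_isomorphic (C00I R I) (C00 R Y).
  apply: (dense_extension_isometry j) => //; first by move=> F [].
    by move=> f; exact: C00I_extension.
  by move=> F; exact: C00_restriction idealI jP cj.
split=> //.
- by split=> //; apply: sup_norm_algebra_norm; exact: C00I_sub_Cb.
- by move=> Z lcZ hZ; exact: C00_iso_homeomorphic.
split=> //.
  split=> // O O0 oO; have [y [Oy [x _ xy]]] := densej O O0 oO.
  by exists y; split=> //; exists x => //; rewrite -jP xy.
split; first exact: unital_C00I_nonproper.
split=> [IT|cY]; last first.
  by apply/null_nbhd_setT; exact: (compact_lambdaX_null _ _ j _ hausdorffX normalX latticeL idealI jP cY).
rewrite -(preimage_setT set_val); apply: compact_set_val; last exact: betaX_compact.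
move=> p _; apply: (closure_null_lambdaX _ setT) => //.
  exact/null_nbhd_setT.
have := closure_dense_range (@to_betaX R X) setT (@to_betaX_dense R X) openT.
by rewrite preimage_setT; exact.
Qed.
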